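(* Let $N$ be a Cartan semigroup in a C*-algebra $A$ with associated semi-Cartan subalgebra $B=C^*(N_+)$. If $N=N(B)$, then $B$ is a MASA (maximal commutative C*-subalgebra) in $A$.
   Context: For a subset $N$ of a C*-algebra $A$, $N_+:=\{n^*n:n\in N\}$ and $C^*(N)$ is the C*-subalgebra generated by $N$. An expectation is a contractive idempotent linear map $A\to A$. $N\subseteq A$ is a Cartan semigroup if: (1) $N$ is a norm-closed *-subsemigroup of $A$ (closed under products and adjoints) with dense linear span in $A$; (2) $B:=C^*(N_+)$ is commutative and contained in $N$; (3) there is an expectation $E$ from $A$ onto $B$ with $E(n)n^*\in B$ for all $n\in N$. Then $B$ is called the associated semi-Cartan subalgebra. The normaliser semigroup of $B$ is $N(B)=\{n\in A:n^*Bn\cup nBn^*\subseteq B\}$. *)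

(* Defs.v *)
From HB Require Import structures.
From mathcomp Require Import all_boot all_order all_algebra.
From mathcomp Require Import all_classical all_reals all_analysis.
From mathcomp Require Import complex.

Set Implicit Arguments.
Unset Strict Implicit.
Unset Printing Implicit Defensive.

Import Order.TTheory GRing.Theory Num.Theory.
Import numFieldNormedType.Exports.

Local Open Scope classical_set_scope.
Local Open Scope ring_scope.

(* C*-algebras need not have a unit, so they cannot be built on the library's
   ring and algebra structures, all of which are unital.  Norms and scalars both
   live in R[i]; the norms are real because the norm of a numDomainType is.    *)
HB.mixin Record CompleteNormedModule_isCStarAlgebra (R : realType) A
    of CompleteNormedModule R[i] A := {
  cmul : A -> A -> A;
  star : A -> A;
  cmulA : associative cmul;
  cmulDl : left_distributive cmul +%R;
  cmulDr : right_distributive cmul +%R;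
  cmulZl : forall (k : R[i]) (a b : A), cmul (k *: a) b = k *: cmul a b;
  cmulZr : forall (k : R[i]) (a b : A), cmul a (k *: b) = k *: cmul a b;
  starK : involutive star;
  starD : {morph star : a b / a + b};
  starZ : forall (k : R[i]) (a : A), star (k *: a) = k^* *: star a;
  starM : forall a b : A, star (cmul a b) = cmul (star b) (star a);
  norm_cmul : forall a b : A, `|cmul a b| <= `|a| * `|b|;
  cstar_norm : forall a : A, `|cmul (star a) a| = `|a| ^+ 2
}.

#[short(type="cstarAlgType")]
HB.structure Definition CStarAlgebra (R : realType) :=
  {A of CompleteNormedModule_isCStarAlgebra R A & CompleteNormedModule R[i] A}.

Notation "a ** b" := (cmul a b) (at level 40, left associativity) : ring_scope.

Record is_cstar_subalg (R : realType) (A : cstarAlgType R) (S : set A) : Prop := {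
  cstar_subalg0 : S 0;
  cstar_subalgD : forall a b, S a -> S b -> S (a + b);
  cstar_subalgZ : forall (k : R[i]) a, S a -> S (k *: a);
  cstar_subalgM : forall a b, S a -> S b -> S (a ** b);
  cstar_subalg_star : forall a, S a -> S (star a);
  cstar_subalg_closed : closed S
}.

Definition commutative_on (R : realType) (A : cstarAlgType R) (S : set A) : Prop :=
  forall a b, S a -> S b -> a ** b = b ** a.

Definition cstar_gen (R : realType) (A : cstarAlgType R) (S : set A) : set A :=
  smallest (@is_cstar_subalg R A) S.

Definition linear_span (R : realType) (A : cstarAlgType R) (S : set A) : set A :=
  [set x | exists (m : nat) (k : 'I_m -> R[i]) (s : 'I_m -> A),
     (forall i, S (s i)) /\ x = \sum_(i < m) k i *: s i].

Definition square_set (R : realType) (A : cstarAlgType R) (N : set A) : set A :=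
  [set star n ** n | n in N].

Definition semi_cartan (R : realType) (A : cstarAlgType R) (N : set A) : set A :=
  cstar_gen (square_set N).

Definition is_expectation (R : realType) (A : cstarAlgType R)
    (E : {linear A -> A}) : Prop :=
  (forall a, `|E a| <= `|a|) /\ idempotent_fun E.

Record cartan_semigroup (R : realType) (A : cstarAlgType R) (N : set A) : Prop := {
  cartan_mul : forall a b, N a -> N b -> N (a ** b);
  cartan_star : forall a, N a -> N (star a);
  cartan_closed : closed N;
  cartan_dense : dense (linear_span N);
  cartan_comm : commutative_on (semi_cartan N);
  cartan_sub : semi_cartan N `<=` N;
  cartan_expectation : exists E : {linear A -> A},
    [/\ is_expectation E, range E = semi_cartan N &
        forall n, N n -> semi_cartan N (E n ** star n)]
}.

Definition normaliser_semigroup (R : realType) (A : cstarAlgType R)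
    (B : set A) : set A :=
  [set n | [set star n ** b ** n | b in B] `|` [set n ** b ** star n | b in B]
           `<=` B].

Definition is_masa (R : realType) (A : cstarAlgType R) (B : set A) : Prop :=
  [/\ is_cstar_subalg B, commutative_on B &
      forall C : set A, is_cstar_subalg C -> commutative_on C ->
        B `<=` C -> C = B].

(* Main.v *)
Require Import Defs.
From mathcomp Require Import all_boot all_order all_algebra.
From mathcomp Require Import all_classical all_reals all_analysis.
From mathcomp Require Import complex ring lra.

Set Implicit Arguments.
Unset Strict Implicit.
Unset Printing Implicit Defensive.

Import Order.TTheory GRing.Theory Num.Theory.
Import numFieldNormedType.Exports.

Local Open Scope classical_set_scope.
Local Open Scope complex_scope.
Local Open Scope ring_scope.

(** Let [B] be the semi-Cartan subalgebra and [E] the expectation onto it, let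
    [S] be a commutative C*-subalgebra containing [B], and let [c] be a
    selfadjoint element of [S]; we show that [c] lies in [B].

    First, [c b star b] lies in [B] for every [b] in [B].  If [U] is the Cayley
    transform of [t c], a unitary multiplier of [S], then [n = U b] satisfies
    [star n n = star b b] and commutes with [B], so it normalises [B]; as all
    normalisers are in [N], the defining property of [E] gives that [E(n) star n]
    is in [B].  Now [n = b + 2 i t c b + O(t^2)] and [E(b) = b], so that the part
    of first order in [t] of [E(n) star n] is [2 i t (E(c b) star b - c b star b)].  Its
    first term is in [B], and letting [t] tend to [0] in the closed set [B]
    yields the claim ([mul_square_mem]).

    Next, [E] preserves selfadjointness on [S] ([contraction_selfadjoint]), so
    [d = c - E(c)] is selfadjoint, [E(d) = 0], and by the first step
    [y = d f^2] is in [B] for all selfadjoint [f] in [B].  Contractivity gives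
    [|s y| <= |d - s y|] for all [s].  But [y] is a nonnegative multiple of [d],
    so for large [s] subtracting [d] from [s y] strictly decreases the norm,
    unless [y = 0] ([contraction_ker]).  Hence [d f^2 = 0].

    Taking for [f] the multiples of [star n n] gives [n d = 0] for all [n] in [N],
    and [d = 0] because the span of [N] is dense ([dense_annihilator]).

    No positivity or functional calculus enters: the only order-theoretic input
    is that [|x|^2 <= |x^2 + y^2|] for commuting selfadjoint [x] and [y], which
    holds because [x^2 + y^2 = star (x + i y) (x + i y)]. *)

(** * Arithmetic and norm of a non-unital C*-algebra *)

Section CStarAlgebraTheory.
Context {R : realType} {A : cstarAlgType R}.
Implicit Types (a b c x y : A) (S : set A).

Lemma cmul0l a : 0 ** a = 0.
Proof. by apply: (addrI (0 ** a)); rewrite -cmulDl !addr0. Qed.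

Lemma cmul0r a : a ** 0 = 0.
Proof. by apply: (addrI (a ** 0)); rewrite -cmulDr !addr0. Qed.

Lemma cmulNl a b : - a ** b = - (a ** b).
Proof. by apply: (addrI (a ** b)); rewrite -cmulDl !subrr cmul0l. Qed.

Lemma cmulNr a b : a ** - b = - (a ** b).
Proof. by apply: (addrI (a ** b)); rewrite -cmulDr !subrr cmul0r. Qed.

Lemma cmulBl a b c : (a - b) ** c = a ** c - b ** c.
Proof. by rewrite cmulDl cmulNl. Qed.

Lemma cmulBr a b c : a ** (b - c) = a ** b - a ** c.
Proof. by rewrite cmulDr cmulNr. Qed.

Lemma star0 : star (0 : A) = 0.
Proof. by apply: (addrI (star 0)); rewrite -starD !addr0. Qed.

Lemma starN a : star (- a) = - star a.
Proof. by apply: (addrI (star a)); rewrite -starD !subrr star0. Qed.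

Lemma starB a b : star (a - b) = star a - star b.
Proof. by rewrite starD starN. Qed.

Lemma starZr (k : R) a : star (k%:C *: a) = k%:C *: star a.
Proof. by rewrite starZ conj_Creal //; apply/complex_realP; exists k. Qed.

Lemma starZi a : star ('i *: a) = - ('i *: star a).
Proof. by rewrite starZ conjCi scaleNr. Qed.

(** The norm takes its values in [R[i]], whose order is only partial;
    its real part is compared in the totally ordered field [R]. *)
Definition nrm a : R := complex.Re `|a|.

Lemma nrmE a : `|a| = (nrm a)%:C.
Proof. by rewrite /nrm RRe_real. Qed.

Lemma nrm_ge0 a : 0 <= nrm a.
Proof. by rewrite -ler0c -nrmE. Qed.

Lemma ler_nrmD a b : nrm (a + b) <= nrm a + nrm b.
Proof. by rewrite -lecR rmorphD /= -!nrmE ler_normD. Qed.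

Lemma nrmN a : nrm (- a) = nrm a.
Proof. by rewrite /nrm normrN. Qed.

Lemma ler_nrmB a b : nrm (a - b) <= nrm a + nrm b.
Proof. by rewrite -(nrmN b) ler_nrmD. Qed.

Lemma ler_nrmM a b : nrm (a ** b) <= nrm a * nrm b.
Proof. by rewrite -lecR rmorphM /= -!nrmE norm_cmul. Qed.

Lemma nrmZr (k : R) a : 0 <= k -> nrm (k%:C *: a) = k * nrm a.
Proof.
move=> k0; apply: (fmorph_inj (real_complex R)).
by rewrite rmorphM /= -!nrmE normrZ ger0_norm // ler0c.
Qed.

Lemma nrmZi a : nrm ('i *: a) = nrm a.
Proof. by rewrite /nrm normrZ normCi mul1r. Qed.

Lemma nrm0_eq0 a : nrm a = 0 -> a = 0.
Proof. by move=> a0; apply: normr0_eq0; rewrite nrmE a0. Qed.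

Lemma nrm_star_sqr a : nrm (star a ** a) = nrm a ^+ 2.
Proof.
by apply: (fmorph_inj (real_complex R)); rewrite rmorphXn /= -!nrmE cstar_norm.
Qed.

Lemma ler_nrm_star a : nrm a <= nrm (star a).
Proof.
have [->|a0] := eqVneq (nrm a) 0; first exact: nrm_ge0.
have : nrm a ^+ 2 <= nrm (star a) * nrm a by rewrite -nrm_star_sqr ler_nrmM.
by rewrite expr2 ler_pM2r // lt_def a0 nrm_ge0.
Qed.

Lemma nrm_star a : nrm (star a) = nrm a.
Proof.
by apply/eqP; rewrite eq_le ler_nrm_star -{2}[a]starK ler_nrm_star.
Qed.

Lemma star_sqr_eq0 a : star a ** a = 0 -> a = 0.
Proof.
move=> a0; apply: nrm0_eq0; apply/eqP.
by rewrite -sqrf_eq0 -nrm_star_sqr a0 /nrm normr0.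
Qed.

Lemma closed_approx S x : closed S ->
  (forall e : R, 0 < e -> exists2 y, S y & nrm (x - y) < e) -> S x.
Proof.
move=> clS appr; apply: clS => U.
move=> /nbhs_normP[e /= e0 eU].
have eE : e = (complex.Re e)%:C by rewrite RRe_real // gtr0_real.
rewrite eE in e0 eU; rewrite ltcR in e0.
have [y Sy xy] := appr _ e0; exists y; split=> //; apply: eU.
by rewrite /ball_ /= nrmE ltcR.
Qed.

Lemma nrmMn a n : nrm (a *+ n) = nrm a *+ n.
Proof.
by apply: (fmorph_inj (real_complex R)); rewrite rmorphMn /= -!nrmE normrMn.
Qed.

Lemma cmulZil a b : 'i *: a ** b = 'i *: (a ** b).
Proof. exact: cmulZl. Qed.

Lemma cmulZir a b : a ** ('i *: b) = 'i *: (a ** b).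
Proof. exact: cmulZr. Qed.

Lemma scaleii a : 'i *: ('i *: a) = - a.
Proof. by rewrite scalerA -expr2 sqrCi scaleN1r. Qed.

Lemma nrm_re_le x y : star x = x -> star y = y -> nrm x <= nrm (x + 'i *: y).
Proof.
move=> sx sy; rewrite -(ler_pMn2r (n := 2)) // -nrmMn.
have -> : x *+ 2 = (x + 'i *: y) + star (x + 'i *: y).
  by rewrite starD starZi sx sy addrACA subrr addr0.
by rewrite (le_trans (ler_nrmD _ _)) // nrm_star.
Qed.

Lemma nrm_im_le x y : star x = x -> star y = y -> nrm y <= nrm (x + 'i *: y).
Proof.
move=> sx sy; have -> : nrm (x + 'i *: y) = nrm (y + 'i *: (- x)).
  by rewrite -[LHS]nrmZi scalerDr scaleii -nrmN opprD opprK addrC scalerN.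
by apply: nrm_re_le; rewrite ?starN ?sx ?sy.
Qed.

Lemma nrm_sqr_addi x y : star x = x -> star y = y -> x ** y = y ** x ->
  nrm (x + 'i *: y) ^+ 2 = nrm (x ** x + y ** y).
Proof.
move=> sx sy xy; rewrite -nrm_star_sqr starD starZi sx sy.
rewrite cmulBl !cmulDr !cmulZil !cmulZir scaleii xy; congr nrm.
by rewrite opprD opprK addrACA addrA subrK.
Qed.

(** This is all that is used of the monotonicity of the norm on positive
    elements: adding a square cannot decrease the norm of a square. *)
Lemma ler_nrm_sqrD x y : star x = x -> star y = y -> x ** y = y ** x ->
  nrm x ^+ 2 <= nrm (x ** x + y ** y).
Proof.
move=> sx sy xy; rewrite -nrm_sqr_addi //.
by rewrite lerXn2r ?nnegrE ?nrm_ge0 // nrm_re_le.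
Qed.

(** * Contractive maps and selfadjoint elements *)

(** The imaginary part [q] of [E h] is amplified by adding [i s q] to [h]: the
    image then has norm at least [(1 + s) |q|], whereas the norm of
    [h + i s q] is at most the square root of [|h|^2 + s^2 |q|^2].  The
    difference of the squares is linear in [s], which forces [q = 0]. *)
Lemma contraction_selfadjoint (E : {linear A -> A}) h p q :
  (forall a, nrm (E a) <= nrm a) ->
  star h = h -> star p = p -> star q = q -> h ** q = q ** h ->
  E h = p + 'i *: q -> E q = q -> q = 0.
Proof.
move=> cE sh sp sq hq Eh Eq; apply: nrm0_eq0; apply/eqP.
rewrite eq_le nrm_ge0 andbT leNgt; apply/negP => q0.
have key s : 0 <= s -> (1 + s *+ 2) * nrm q ^+ 2 <= nrm h ^+ 2.
  move=> s0.
  have sy : star (s%:C *: q) = s%:C *: q by rewrite starZr sq.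
  have : ((1 + s) * nrm q) ^+ 2 <= nrm (h + 'i *: (s%:C *: q)) ^+ 2.
    rewrite lerXn2r ?nnegrE ?mulr_ge0 ?nrm_ge0 ?addr_ge0 //.
    apply: le_trans (cE _).
    rewrite linearD linearZ /= linearZ /= Eq Eh -addrA -scalerDr.
    rewrite -nrmZr ?addr_ge0 // rmorphD rmorph1 scalerDl scale1r.
    by apply: nrm_im_le => //; rewrite starD sy sq.
  rewrite nrm_sqr_addi // ?cmulZl ?cmulZr ?hq // => /le_trans/(_ (ler_nrmD _ _)).
  have hh := ler_nrmM h h; have qq := ler_nrmM q q.
  rewrite !nrmZr // => H.
  have s2 : s * (s * nrm (q ** q)) <= s * (s * (nrm q * nrm q)).
    by rewrite ler_wpM2l // ler_wpM2l.
  nra.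
have q2 : 0 < nrm q ^+ 2 by rewrite exprn_gt0.
have h2 := sqr_ge0 (nrm h).
(* With this [s], [key] reads [|q|^2 + 2 |h|^2 <= |h|^2]. *)
have := key (nrm h ^+ 2 / nrm q ^+ 2) (divr_ge0 h2 (ltW q2)).
rewrite mulrDl mul1r mulrnAl divfK ?gt_eqF //; lra.
Qed.

(** Put [y = d f^2].  Since [E (d - s y) = - s y], [|s y| <= |d - s y|] for all
    [s].  On the other hand
    [(d - s y)^2 = d^2 + (s^2 - 2 s) y^2 - 2 s (d y - y^2)], where
    [d y - y^2 = d^2 f^2 (1 - f^2)] is nonnegative as [|f| <= 1].  A square root
    of [1 - f^2] is avoided by using the square of [d f (1 - f^2 / 2)], which
    exceeds [d y - y^2] only by [d^2 f^6 / 4 = (y f)^2 / 4].  Adding [2 s] times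
    it to [(d - s y)^2] gives
    [s^2 |y|^2 <= |d|^2 + (s^2 - 2 s) |y|^2 + s / 2 |y|^2] for [s >= 2], which
    for large [s] is possible only if [y = 0]. *)
Lemma contraction_ker (E : {linear A -> A}) d f :
  (forall a, nrm (E a) <= nrm a) ->
  star d = d -> star f = f -> d ** f = f ** d -> nrm f <= 1 ->
  E d = 0 -> E (d ** f ** f) = d ** f ** f -> d ** f ** f = 0.
Proof.
move=> cE sd sf df f1 Ed; set p := d ** f; set y := p ** f => Ey.
pose q := y ** f.
have sp : star p = p by rewrite starM sd sf -df.
have pf : p ** f = f ** p by rewrite /p cmulA -df -!cmulA.
have sy : star y = y by rewrite starM sp sf -pf.
have yf : y ** f = f ** y by rewrite /y cmulA -pf -!cmulA.
have sq : star q = q by rewrite starM sy sf -yf.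
have dp : d ** p = p ** d by rewrite /p -cmulA -df cmulA.
have dy : d ** y = y ** d by rewrite /y -cmulA -df cmulA dp -cmulA.
have pp : p ** p = d ** y by rewrite {1}/p -cmulA -pf.
have py : p ** y = y ** p by rewrite /y -cmulA -pf cmulA.
have pq : p ** q = y ** y by rewrite /q cmulA py -cmulA.
have qp : q ** p = y ** y by rewrite /q -cmulA -pf.
have dq : d ** q = q ** d by rewrite /q -cmulA -df cmulA dy -cmulA.
have yq : y ** q = q ** y by rewrite /q -cmulA -yf cmulA.
have nq : nrm q <= nrm y.
  by apply: le_trans (ler_nrmM _ _) _; rewrite ler_piMr ?nrm_ge0.
have key u : 1 <= u -> 3 * u ^+ 2 * nrm y ^+ 2 <= nrm d ^+ 2.
  (* [k] is the [s] above; writing it as [2 u^2] makes [2 s] a square, and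
     [z] is [2 u d f (1 - f^2 / 2)]. *)
  move=> u1; pose k := u ^+ 2 *+ 2.
  have u0 : 0 <= u by lra.
  have k0 : 0 <= k by rewrite /k; nra.
  pose x := d - k%:C *: y; pose z := u%:C *: (p *+ 2 - q).
  have sx : star x = x by rewrite starB starZr sd sy.
  have sz : star z = z by rewrite starZr starB mulr2n starD sp sq.
  have xz : x ** z = z ** x.
    rewrite /x /z cmulZl cmulZr; congr (_ *: _); rewrite mulr2n.
    rewrite !(cmulBl, cmulBr, cmulDl, cmulDr) !cmulZl !cmulZr.
    by rewrite dp dq py yq.
  have xE : nrm (E x) = k * nrm y.
    by rewrite linearB linearZ /= Ed Ey sub0r nrmN nrmZr.
  have sumE : x ** x + z ** z =
      d ** d + (u ^+ 4 *+ 4 - u ^+ 2 *+ 4)%:C *: (y ** y)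
             + (u ^+ 2)%:C *: (q ** q).
    have xx : x ** x =
        d ** d - (u ^+ 2 *+ 4)%:C *: (d ** y) + (u ^+ 4 *+ 4)%:C *: (y ** y).
      rewrite /x cmulBl !cmulBr !cmulZl !cmulZr scalerA -rmorphM -dy /= opprB.
      rewrite addrA addrAC -(addrA (d ** d)) -opprD -scalerDl -rmorphD /=.
      by congr (_ - _%:C *: _ + _%:C *: _); rewrite /k; ring.
    have zz : z ** z = (u ^+ 2 *+ 4)%:C *: (d ** y)
        - (u ^+ 2 *+ 4)%:C *: (y ** y) + (u ^+ 2)%:C *: (q ** q).
      have ww : (p *+ 2 - q) ** (p *+ 2 - q) =
                (d ** y) *+ 4 - (y ** y) *+ 4 + q ** q.
        rewrite mulr2n cmulBl !cmulBr !cmulDl !cmulDr pp pq qp.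
        rewrite -!mulr2n -!mulrnA opprB [LHS]addrA [LHS]addrAC; congr (_ + _).
        by rewrite -addrA -opprD -mulrnDr.
      rewrite {1}/z cmulZl {1}/z cmulZr scalerA -rmorphM -expr2 ww scalerDr scalerBr.
      by rewrite -!scalerMnr !(scalerMnl _ (_ ** _)) -!(rmorphMn (real_complex R)).
    rewrite xx zz rmorphB /= scalerBl !addrA; congr (_ - _ + _).
    by rewrite addrAC subrK.
  have : (k * nrm y) ^+ 2 <= nrm (x ** x + z ** z).
    apply: le_trans (ler_nrm_sqrD sx sz xz).
    by rewrite -xE lerXn2r ?nnegrE ?nrm_ge0.
  rewrite sumE => /le_trans/(_ (ler_nrmD _ _)).
  have := ler_nrmD (d ** d) ((u ^+ 4 *+ 4 - u ^+ 2 *+ 4)%:C *: (y ** y)).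
  have u2 : 1 <= u ^+ 2 by nra.
  have u4 : u ^+ 4 = u ^+ 2 * u ^+ 2 by ring.
  have v0 : 0 <= u ^+ 4 *+ 4 - u ^+ 2 *+ 4 by rewrite u4; nra.
  rewrite !nrmZr ?sqr_ge0 //.
  have := ler_wpM2l v0 (ler_nrmM y y).
  have := ler_wpM2l (sqr_ge0 u) (ler_nrmM q q).
  have := ler_wpM2l (sqr_ge0 u) (ler_pM (nrm_ge0 q) (nrm_ge0 q) nq nq).
  have := ler_nrmM d d.
  rewrite /k; lra.
apply: nrm0_eq0; apply/eqP; rewrite eq_le nrm_ge0 andbT leNgt.
apply/negP => y0.
have y2 : 0 < nrm y ^+ 2 by rewrite exprn_gt0.
have v0 : 0 <= nrm d ^+ 2 / nrm y ^+ 2 by rewrite divr_ge0 ?sqr_ge0.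
have vE : nrm d ^+ 2 / nrm y ^+ 2 * nrm y ^+ 2 = nrm d ^+ 2.
  by rewrite divfK ?gt_eqF.
set v := _ / _ in v0 vE.
have := key (1 + v); rewrite -vE lerDl => /(_ v0).
by rewrite ler_pM2r //; nra.
Qed.

(** * Neumann series *)

Lemma nrm_cauchy_cvg (u : nat -> A) :
  (forall e : R, 0 < e -> exists k0, forall k, (k0 <= k)%N ->
     nrm (u k - u k0) < e) ->
  exists l, forall e : R, 0 < e -> exists k0, forall k, (k0 <= k)%N ->
     nrm (l - u k) < e.
Proof.
move=> cu; have : cauchy (u @ \oo).
  apply: cauchy_exP => eps eps0.
  have eE : eps = (complex.Re eps)%:C by rewrite RRe_real // gtr0_real.
  rewrite eE in eps0 *; rewrite ltcR in eps0.
  have [k0 k0P] := cu _ eps0; exists (u k0); exists k0 => //= k kk0.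
  by rewrite -ball_normE /ball_ /= distrC nrmE ltcR; exact: k0P.
move=> /cauchy_cvgP; set l := lim _ => ul; exists l => e e0.
have eC : 0 < e%:C :> R[i] by rewrite ltcR.
have /cvgrPdist_lt/(_ _ eC)[k0 _ k0P] := ul.
by exists k0 => k /k0P; rewrite nrmE ltcR.
Qed.

Lemma geometric_cauchy (u : nat -> A) (K : R) :
  (forall k, nrm (u k.+1 - u k) <= K / 2 ^+ k) ->
  forall e : R, 0 < e -> exists k0, forall k, (k0 <= k)%N ->
     nrm (u k - u k0) < e.
Proof.
move=> uK e e0.
have K0 : 0 <= K by have := uK 0%N; rewrite expr0 divr1; apply: le_trans (nrm_ge0 _).
have [k0 k0P] : exists k0, 2 * K / 2 ^+ k0 < e.
  exists (Num.bound (2 * K / e)); rewrite ltr_pdivrMr ?exprn_gt0 //.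
  by rewrite [ltRHS]mulrC -ltr_pdivrMr //; exact: upper_nthrootP.
exists k0 => k /subnKC <-; apply: le_lt_trans k0P.
have : nrm (u (k0 + (k - k0))%N - u k0) <=
       2 * K / 2 ^+ k0 - 2 * K / 2 ^+ (k0 + (k - k0))%N.
  elim: (k - k0)%N => [|m IH]; first by rewrite addn0 !subrr /nrm normr0.
  rewrite addnS -(subrKA (u (k0 + m)%N)); apply: le_trans (ler_nrmD _ _) _.
  apply: le_trans (lerD (uK _) IH) _.
  rewrite exprS invfM mulrA -[2 * K * 2^-1]mulrAC divff // mul1r; nra.
by move=> /le_trans; apply; rewrite gerBl divr_ge0 ?mulr_ge0 ?exprn_ge0.
Qed.

(** The solution [(1 - v)^-1 b], obtained by iteration because there is no unit
    to form the inverse. *)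
Lemma neumann_solution S b v : is_cstar_subalg S -> S b -> S v ->
  nrm v <= 2^-1 -> exists2 m, S m & m = b + v ** m.
Proof.
move=> SC Sb Sv v2; pose u := fix u k := if k is k'.+1 then b + v ** u k' else 0.
have uS k : S (u k).
  elim: k => [|k IH] /=; first exact: cstar_subalg0 SC.
  by apply: cstar_subalgD => //; apply: cstar_subalgM.
have uK k : nrm (u k.+1 - u k) <= nrm b / 2 ^+ k.
  elim: k => [|k IH]; first by rewrite /= cmul0r addr0 subr0 expr0 divr1.
  rewrite [u k.+2]/= [in X in _ - X]/= opprD addrACA subrr add0r -cmulBr.
  rewrite exprS invfM mulrCA; apply: le_trans (ler_nrmM _ _) _.
  by apply: ler_pM => //; exact: nrm_ge0.
have [l lP] := nrm_cauchy_cvg (geometric_cauchy uK).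
exists l.
  apply: closed_approx (cstar_subalg_closed SC) _ => e /lP[k kP].
  by exists (u k) => //; exact: kP.
apply/eqP; rewrite -subr_eq0; apply/eqP/nrm0_eq0/eqP.
rewrite eq_le nrm_ge0 andbT; apply/ler_addgt0Pl => e e0; rewrite addr0.
have e2 : 0 < e / 2 by rewrite divr_gt0.
have [k kP] := lP _ e2.
have -> : l - (b + v ** l) = (l - u k.+1) - v ** (l - u k).
  by rewrite /= cmulBr opprB !opprD !addrA subrK.
apply: le_trans (ler_nrmB _ _) _.
have := kP _ (leqnSn k); have := kP _ (leqnn k).
have := ler_nrmM v (l - u k); have := nrm_ge0 (l - u k); have := nrm_ge0 v.
nra.
Qed.

(** * Cayley transforms and multiplication by an element of the commutant *)

Lemma cstar_subalgN S a : is_cstar_subalg S -> S a -> S (- a).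
Proof. by move=> SS Sa; rewrite -scaleN1r; apply: cstar_subalgZ. Qed.

Lemma cstar_subalgB S a b : is_cstar_subalg S -> S a -> S b -> S (a - b).
Proof. by move=> SS Sa Sb; apply: cstar_subalgD => //; apply: cstar_subalgN. Qed.

(** The element [m + i w] is [U b] for the Cayley transform
    [U = (1 + i t c) (1 - i t c)^-1] of [t c], with [m = (1 - i t c)^-1 b] and
    [w = t c m]; the last equation says that [U] is unitary.  A Cayley transform
    only needs a Neumann series, where the unitary [exp (i t c)] would need
    the exponential series and its functional equation. *)
Lemma cayley_transform S b c (t : R) : is_cstar_subalg S -> commutative_on S ->
  S b -> S c -> star c = c -> 0 <= t -> t * nrm c <= 2^-1 ->
  exists m, let w := t%:C *: (c ** m) in
    [/\ S m, nrm m <= 2 * nrm b, m = b + 'i *: w &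
        star (m + 'i *: w) ** (m + 'i *: w) = star b ** b].
Proof.
move=> SS cS Sb Sc sc t0 tc; pose v := 'i *: (t%:C *: c).
have Sv : S v by do 2!apply: cstar_subalgZ => //.
have nv : nrm v <= 2^-1 by rewrite nrmZi nrmZr.
have [m Sm mE] := neumann_solution SS Sb Sv nv; exists m => w.
have vm : v ** m = 'i *: w by rewrite !cmulZl.
rewrite vm in mE; split=> //.
  have nw : nrm ('i *: w) <= 2^-1 * nrm m.
    by rewrite -vm (le_trans (ler_nrmM _ _)) // ler_wpM2r ?nrm_ge0.
  have := ler_nrmD b ('i *: w); rewrite -mE; lra.
have bE : b = m - 'i *: w by rewrite {1}mE addrK.
have mw : star m ** w = star w ** m.
  by rewrite /w starZr starM sc cmulZl cmulZr cmulA.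
rewrite bE starD starB starZi opprK cmulBl !cmulDl !cmulBr !cmulDr.
rewrite !cmulZil !cmulZir mw.
by rewrite opprD !addrA addrK subrK.
Qed.

(** The first-order expansion in [t] of [E n ** star n], where [n] is the Cayley
    transform of [t c] applied to [b], is carried out with exact remainders: for
    each [t] it produces an element of [B] at distance at most
    [10 t |c|^2 |b|^2] from [c b star b]. *)
Lemma mul_square_mem (B S : set A) (E : {linear A -> A}) b c :
  is_cstar_subalg B -> is_cstar_subalg S -> commutative_on S -> B `<=` S ->
  (forall a, nrm (E a) <= nrm a) -> (forall a, B (E a)) ->
  (forall a, B a -> E a = a) ->
  (forall n, S n -> B (star n ** n) -> B (E n ** star n)) ->
  B b -> S c -> star c = c -> B (c ** (b ** star b)).
Proof.
move=> BB SS cS BS cE EB EI key Bb Sc sc.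
have Sb := BS _ Bb.
apply: closed_approx (cstar_subalg_closed BB) _ => e e0.
pose K := 10 * (nrm c ^+ 2 * nrm b ^+ 2).
have c0 := nrm_ge0 c; have b0 := nrm_ge0 b.
have K0 : 0 <= K by rewrite !mulr_ge0 ?sqr_ge0.
(* The two summands of [D] make [t |c| <= 1 / 2] and [t K < e] hold for
   [t = e / D]. *)
pose D := e * (1 + 2 * nrm c) + K.
have D0 : 0 < D by rewrite /D; nra.
pose t := e / D.
have t0 : 0 < t by rewrite divr_gt0.
have tc : t * nrm c <= 2^-1.
  by rewrite /t mulrAC ler_pdivrMr // /D; nra.
have tK : t * K < e.
  by rewrite /t mulrAC ltr_pdivrMr // ltr_pM2l // /D; nra.
have [m []] := cayley_transform SS cS Sb Sc sc (ltW t0) tc.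
set w := t%:C *: (c ** m) => Sm nm mE nn.
have := key (m + 'i *: w); set n := m + _ in nn *.
have nE : n = b + ('i *: w) *+ 2 by rewrite /n {1}mE -addrA -mulr2n.
have Sw : S w by apply: cstar_subalgZ => //; apply: cstar_subalgM.
have Sn : S n by apply: cstar_subalgD => //; apply: cstar_subalgZ.
rewrite nn => /(_ Sn (cstar_subalgM BB (cstar_subalg_star BB Bb) Bb)).
have starnE : star n = star b - ('i *: star w) *+ 2.
  by rewrite nE starD !mulr2n starD starZi -opprD.
have -> : E n = b + ('i *: E w) *+ 2.
  by rewrite nE raddfD raddfMn /= linearZ /= EI.
rewrite starnE => Bbeta.
(* [i g] is [2 t c b star b] up to second order in [t]. *)
pose g := (b + 'i *: E w *+ 2) ** (star b - 'i *: star w *+ 2)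
          - b ** star b - ('i *: (E w ** star b)) *+ 2.
have Bg : B g.
  have Bsb := cstar_subalg_star BB Bb.
  apply: (cstar_subalgB BB); first apply: (cstar_subalgB BB) => //.
    exact: cstar_subalgM.
  have : B ('i *: (E w ** star b)).
    by apply: (cstar_subalgZ BB); apply: cstar_subalgM.
  by move=> H; rewrite mulr2n; apply: cstar_subalgD.
have igE : 'i *: g = (b ** star w) *+ 2 + ('i *: (E w ** star w)) *+ 4.
  have e1 : 'i *: E w *+ 2 ** star b = ('i *: (E w ** star b)) *+ 2.
    by rewrite !mulr2n cmulDl cmulZil.
  have e2 : b ** ('i *: star w *+ 2) = ('i *: (b ** star w)) *+ 2.
    by rewrite !mulr2n cmulDr cmulZir.
  have e3 : 'i *: E w *+ 2 ** ('i *: star w *+ 2) = - (E w ** star w) *+ 4.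
    rewrite !mulr2n cmulDl !cmulDr !cmulZil !cmulZir !scaleii.
    by rewrite -!mulr2n -mulrnA.
  rewrite /g cmulBr !(cmulDl b) e1 e2 e3 [_ + _ - b ** _]addrAC (addrAC (b ** _)).
  rewrite subrr add0r addrAC subrr add0r scalerN scalerDr -!scalerMnr.
  by rewrite scalerN scaleii opprD -!mulNrn !opprK.
(* From [star w = t star m c] and [star m = star b - i star w] *)
have bw : t%:C *: (c ** (b ** star b)) =
          b ** star w + 'i *: (t%:C *: (b ** star w ** c)).
  have -> : c ** (b ** star b) = b ** star b ** c.
    by apply: cS => //; apply: cstar_subalgM => //; apply: cstar_subalg_star.
  have sbE : star b = star m + 'i *: star w.
    by rewrite mE starD starZi subrK.
  have swE : star w = t%:C *: (star m ** c) by rewrite starZr starM sc.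
  rewrite sbE cmulDr cmulDl scalerDr cmulZir cmulZil scalerA mulrC -scalerA.
  by congr (_ + _); rewrite swE cmulZr cmulA.
exists ((2 * t)^-1%:C *: ('i *: g)); first by do 2!apply: (cstar_subalgZ BB).
set x := _ - _.
have xE : (2 * t)%:C *: x = 'i *: (t%:C *: (b ** star w ** c)) *+ 2
                            - ('i *: (E w ** star w)) *+ 4.
  have t2 : 2 * t != 0 by rewrite mulf_neq0 ?gt_eqF.
  rewrite scalerBr [X in _ - X]scalerA -rmorphM mulfV // scale1r igE.
  rewrite mulr_natl rmorphMn -scalerMnl bw mulrnDl opprD addrACA.
  by rewrite addrA subrr add0r.
have t20 : 0 <= 2 * t by rewrite mulr_ge0 // ltW.
have H1 : 2 * t * nrm x <=
    (t * nrm (b ** star w ** c)) *+ 2 + (nrm (E w ** star w)) *+ 4.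
  rewrite -nrmZr // xE (le_trans (ler_nrmB _ _)) //.
  by rewrite !nrmMn !nrmZi nrmZr // ltW.
have w0 := nrm_ge0 w; have Ew0 := nrm_ge0 (E w).
have H2 : nrm (b ** star w ** c) <= nrm b * nrm w * nrm c.
  rewrite (le_trans (ler_nrmM _ _)) // ler_wpM2r // -(nrm_star w).
  exact: ler_nrmM.
have H3 : nrm (E w ** star w) <= nrm w * nrm w.
  rewrite (le_trans (ler_nrmM _ _)) // nrm_star ler_wpM2r //.
have H4 : nrm w <= t * (nrm c * (2 * nrm b)).
  rewrite (nrmZr _ (ltW t0)) ler_pM2l // (le_trans (ler_nrmM _ _)) //.
  by rewrite ler_wpM2l.
set W := t * _ in H4.
have H5 : nrm w * nrm w <= W * W by apply: ler_pM.
have H6 : nrm b * nrm w * nrm c <= nrm b * W * nrm c.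
  by rewrite ler_wpM2r // ler_wpM2l.
have H7 : t * nrm (b ** star w ** c) <= t * (nrm b * W * nrm c).
  by rewrite ler_pM2l // (le_trans H2).
have : 2 * t * nrm x <= 2 * t * (t * K).
  have -> : 2 * t * (t * K) = (t * (nrm b * W * nrm c)) *+ 2 + (W * W) *+ 4.
    by rewrite /K /W; ring.
  by rewrite (le_trans H1) // lerD // lerMn2r //= (le_trans H3).
by rewrite (ler_pM2l (mulr_gt0 _ t0)) // => /le_lt_trans; exact.
Qed.

(** * The semi-Cartan subalgebra is maximal commutative *)

Lemma cartesian_decomposition S a : is_cstar_subalg S -> S a ->
  exists p q, [/\ S p, S q, star p = p, star q = q & a = p + 'i *: q].
Proof.
move=> SS Sa; have Ssa := cstar_subalg_star SS Sa.
pose h : R := 2^-1.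
exists (h%:C *: (a + star a)), (h%:C *: ('i *: (star a - a))); split.
- by apply: (cstar_subalgZ SS); apply: cstar_subalgD.
- by do 2!apply: (cstar_subalgZ SS); apply: cstar_subalgB.
- by rewrite starZr starD starK addrC.
- by rewrite starZr starZi starB starK -scalerN opprB.
rewrite scalerA mulrC -scalerA scaleii opprB -scalerDr addrACA subrr addr0.
by rewrite -mulr2n -scalerMnr scalerMnl -rmorphMn /h -mulr_natl mulfV // scale1r.
Qed.

Lemma is_cstar_subalg_gen S : is_cstar_subalg (cstar_gen S).
Proof.
split.
- by move=> T [TT _]; apply: cstar_subalg0 TT.
- move=> a b Sa Sb T [TT ST].
  by apply: cstar_subalgD => //; [apply: Sa | apply: Sb].
- by move=> k a Sa T [TT ST]; apply: cstar_subalgZ => //; apply: Sa.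
- move=> a b Sa Sb T [TT ST].
  by apply: cstar_subalgM => //; [apply: Sa | apply: Sb].
- by move=> a Sa T [TT ST]; apply: cstar_subalg_star => //; apply: Sa.
- move=> x clx T [TT ST]; apply: (cstar_subalg_closed TT).
  by apply: closureS clx => y; apply.
Qed.

(** An [m] in the span close to [star d] satisfies [m ** d = 0], so that
    [|d|^2 = |(star d - m) d|], which is less than [|d|^2] if [d] is nonzero. *)
Lemma dense_annihilator S d : dense (linear_span S) ->
  (forall n, S n -> n ** d = 0) -> d = 0.
Proof.
move=> dS nd; apply: nrm0_eq0; apply/eqP; rewrite eq_le nrm_ge0 andbT leNgt.
apply/negP => d0.
have e0 : 0 < `|d| by rewrite nrmE ltcR.
have sne0 : ball (star d) `|d| !=set0 by exists (star d); apply: ballxx.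
have [v [dv [m [k [s [Ss vE]]]]]] := dS _ sne0 (ball_open _ _).
have vd : v ** d = 0.
  rewrite vE; elim/big_ind: _ => [|x y xd yd|i _]; first exact: cmul0l.
    by rewrite cmulDl xd yd addr0.
  by rewrite cmulZl nd ?scaler0.
rewrite -ball_normE /ball_ /= !nrmE ltcR in dv.
have : nrm d ^+ 2 < nrm d ^+ 2.
  rewrite -{1}nrm_star_sqr -[X in nrm X]subr0 -vd -cmulBl.
  by rewrite (le_lt_trans (ler_nrmM _ _)) // expr2 ltr_pM2r.
by rewrite ltxx.
Qed.

End CStarAlgebraTheory.

Theorem theorem12p3 (R : realType) (A : cstarAlgType R) (N : set A) :
  cartan_semigroup N ->
  N = normaliser_semigroup (semi_cartan N) ->
  is_masa (semi_cartan N).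
Proof.
move=> cN NE; set B := semi_cartan N in NE *.
have BB : is_cstar_subalg B by exact: is_cstar_subalg_gen.
have cB : commutative_on B := cartan_comm cN.
split=> // S SS cS BS; apply/seteqP; split=> // c0 Sc0.
have [E [[cE idE] rE keyE]] := cartan_expectation cN.
have nE a : nrm (E a) <= nrm a by rewrite -lecR -!nrmE; exact: cE.
have EB a : B (E a) by rewrite /B -rE; exists a.
have EI a : B a -> E a = a by rewrite /B -rE => -[x _ <-]; exact: idE.
have Sstar a : S a -> S (star a) by exact: cstar_subalg_star.
have SM a b : S a -> S b -> S (a ** b) by exact: cstar_subalgM.
(* An [n] in [S] commutes with [B], so [star n ** n] in [B] suffices for [n] to
   normalise [B], that is, to lie in [N]. *)
have key n : S n -> B (star n ** n) -> B (E n ** star n).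
  move=> Sn Bnn; apply: keyE; rewrite NE => x [] [b Bb <-] {x}; have Sb := BS _ Bb.
    rewrite -cmulA (cS b) // cmulA.
    exact: (cstar_subalgM BB).
  rewrite (cS n b) // -cmulA (cS n (star n)) //; last exact: Sstar.
  exact: (cstar_subalgM BB).
suff saP c : S c -> star c = c -> B c.
  have [p [q [Sp Sq sp sq ->]]] := cartesian_decomposition SS Sc0.
  by apply: (cstar_subalgD BB); [|apply: (cstar_subalgZ BB)]; apply: saP.
move=> Sc sc.
have [p [q [Bp Bq sp sq Ec]]] := cartesian_decomposition BB (EB c).
have q0 : q = 0.
  apply: (contraction_selfadjoint nE sc sp sq _ Ec (EI _ Bq)).
  by apply: cS => //; exact: BS.
rewrite q0 scaler0 addr0 in Ec.
have Ed : E (c - p) = 0 by rewrite linearB /= Ec EI // subrr.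
have sd : star (c - p) = c - p by rewrite starB sc sp.
have Sd : S (c - p) by apply: cstar_subalgB => //; exact: BS.
have dff f : B f -> star f = f -> nrm f <= 1 -> (c - p) ** f ** f = 0.
  move=> Bf sf f1; apply: (contraction_ker nE sd sf _ f1 Ed).
    by apply: cS => //; exact: BS.
  apply: (EI); rewrite -cmulA cmulBl; apply: (cstar_subalgB BB).
    rewrite -{2}sf.
    exact: (mul_square_mem BB SS cS BS nE EB EI key).
  by apply: (cstar_subalgM BB) => //; exact: (cstar_subalgM BB).
have dN n : N n -> n ** (c - p) = 0.
  move=> Nn; have Bx : B (star n ** n) by move=> T [TT]; apply; exists n.
  have Sx := BS _ Bx; have sx : star (star n ** n) = star n ** n.
    by rewrite starM starK.
  set x := star n ** n in Bx Sx sx.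
  pose k := (1 + nrm x)^-1; have k0 : 0 < k by rewrite invr_gt0 ltr_wpDr ?nrm_ge0.
  have dxx : (c - p) ** x ** x = 0.
    have : (c - p) ** (k%:C *: x) ** (k%:C *: x) = 0.
      apply: dff; first exact: (cstar_subalgZ BB).
        by rewrite starZr sx.
      by rewrite (nrmZr _ (ltW k0)) ler_pdivrMl ?ltr_wpDr ?nrm_ge0 // mulr1 lerDr ler01.
    rewrite !(cmulZl, cmulZr) scalerA => /eqP; rewrite scaler_eq0.
    by rewrite mulf_eq0 orbb fmorph_eq0 gt_eqF //= => /eqP.
  have dx : (c - p) ** x = 0.
    have dxC : x ** (c - p) = (c - p) ** x by exact: cS.
    apply: star_sqr_eq0; rewrite starM sx sd.
    by rewrite -dxC {1}dxC cmulA dxx cmul0l.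
  apply: star_sqr_eq0.
  by rewrite starM sd cmulA -(cmulA _ (star n)) dx cmul0l.
have /eqP := dense_annihilator (cartan_dense cN) dN.
by rewrite subr_eq0 => /eqP ->.
Qed.
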